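(* Let $\mathbb{K}=\mathbb{R}$ or $\mathbb{C}$ and let $A\in\mathbb{K}^{m\times n}$, $B\in\mathbb{K}^{n\times k}$. The following conditions are equivalent: (i) $(AB)^{+}=B^{+}A^{+}$; (ii) there exist essential reduced singular value decompositions $A=U_A\Sigma_A V_A^*$ and $B=U_B\Sigma_B V_B^*$ such that $$V_A^*U_B=\begin{bmatrix} Q & 0\\ 0 & 0\end{bmatrix},$$ where $Q$ is a unitary matrix, or $V_A^*U_B=0$; (iii) $\mathcal{C}(A^*AB)=\mathcal{C}(BB^*A^* )$; (iv) $\big((A^*A)(BB^* )\big)^{+}=(BB^* )^{+}(A^*A)^{+}$; (v) $A^{+}A$ commutes with $BB^*$ and $BB^{+}$ commutes with $A^*A$.
   Context: $M^*$ is the conjugate transpose, $M^{+}$ the Moore--Penrose pseudoinverse, and $\mathcal{C}(M)$ the column space of $M$. Over $\mathbb{R}$, unitary means orthogonal. An essential reduced singular value decomposition of a matrix $M\in\mathbb{K}^{p\times q}$ of rank $r$ is a factorization $M=U\Sigma V^*$ with $U\in\mathbb{K}^{p\times r}$, $V\in\mathbb{K}^{q\times r}$ having orthonormal columns ($U^*U=V^*V=I$) and $\Sigma=\operatorname{diag}(\sigma_1,\ldots,\sigma_r)\in\mathbb{R}^{r\times r}$ with $\sigma_1\ge\sigma_2\ge\ldots\ge\sigma_r>0$. Zero blocks in the displayed matrix may be empty.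
   Formalization: In (ii) the block form of V_A^*U_B is required only up to a permutation of rows and columns: with decreasingly ordered singular values, A=diag(2,1), B=(0,1)^T satisfy (i) but V_A^*U_B=(0,u)^T, |u|=1, is not of the displayed form. *)

(* Defs.v *)
From HB Require Import structures.
From mathcomp Require Import all_boot all_order all_fingroup all_algebra.
From mathcomp Require Import reals.
From mathcomp Require Import complex.

Set Implicit Arguments.
Unset Strict Implicit.
Unset Printing Implicit Defensive.

Import Order.TTheory GRing.Theory Num.Theory.
Local Open Scope ring_scope.

Reserved Notation "A ^H" (at level 1, format "A ^H").
Reserved Notation "A ^MP" (at level 1, format "A ^MP").

Variant base_field := RealField | ComplexField.

Definition scalars (R : realType) (F : base_field) : numFieldType :=
  match F with
  | RealField => R
  | ComplexField => R[i]
  end.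

Definition scalar_conj (R : realType) (F : base_field) :
    {rmorphism scalars R F -> scalars R F} :=
  match F with
  | RealField => (idfun : {rmorphism R -> R})
  | ComplexField => (@conjc R : {rmorphism R[i] -> R[i]})
  end.

Definition scalar_of_real (R : realType) (F : base_field) :
    {rmorphism R -> scalars R F} :=
  match F with
  | RealField => (idfun : {rmorphism R -> R})
  | ComplexField => (real_complex R : {rmorphism R -> R[i]})
  end.

Section Scalar.
Variables (R : realType) (F : base_field).
Local Notation K := (scalars R F).
Local Notation conj := (scalar_conj R F).

Lemma scalar_conjK : involutive conj.
Proof. by case: F => //=; exact: conjcK. Qed.

Lemma scalar_mul_conj (x : K) : conj x * x = `|x| ^+ 2.
Proof.
case: F x => /= x; last by rewrite mulrC -sqr_normc.
by rewrite real_normK ?num_real ?expr2.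
Qed.

Definition adjmx m n (A : 'M[K]_(m, n)) : 'M[K]_(n, m) := map_mx conj A^T.
Local Notation "A ^H" := (adjmx A) : ring_scope.

Lemma adjmxK m n (A : 'M[K]_(m, n)) : A^H^H = A.
Proof. by apply/matrixP => i j; rewrite !mxE scalar_conjK. Qed.

Lemma adjmxM m n p (A : 'M[K]_(m, n)) (B : 'M[K]_(n, p)) :
  (A *m B)^H = B^H *m A^H.
Proof. by rewrite /adjmx trmx_mul map_mxM. Qed.

Lemma adjmx_mul_eq0 m n (A : 'M[K]_(m, n)) : (A^H *m A == 0) = (A == 0).
Proof.
apply/eqP/eqP => [AA0 | ->]; last by rewrite mulmx0.
apply/matrixP => i j; rewrite [RHS]mxE.
have /eqP := congr1 (fun M : 'M_n => M j j) AA0.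
rewrite !mxE psumr_eq0 => [/allP/(_ i)|k _].
  rewrite mem_index_enum => /(_ isT) /=.
  by rewrite !mxE scalar_mul_conj expf_eq0 normr_eq0 /= => /eqP.
by rewrite !mxE scalar_mul_conj exprn_ge0.
Qed.

Lemma adjmx0 m n : (0 : 'M[K]_(m, n))^H = 0.
Proof. by rewrite /adjmx trmx0 map_mx0. Qed.

Lemma adjmx1 n : (1%:M : 'M[K]_n)^H = 1%:M.
Proof. by rewrite /adjmx trmx1 map_mx1. Qed.

Lemma adjmx_inv n (A : 'M[K]_n) : (invmx A)^H = invmx A^H.
Proof. by rewrite /adjmx trmx_inv map_invmx. Qed.

Lemma adjmx_gram_unit m r (A : 'M[K]_(m, r)) :
  row_full A -> A^H *m A \in unitmx.
Proof.
move=> /row_fullP[B BA1]; rewrite -row_free_unit -kermx_eq0.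
set N := kermx _.
have /eqP NA0 : A *m N^H == 0.
  rewrite -adjmx_mul_eq0 adjmxM adjmxK mulmxA -(mulmxA N) mulmx_ker.
  by rewrite mul0mx.
by rewrite -[N]adjmxK -[N^H]mul1mx -BA1 -mulmxA NA0 mulmx0 adjmx0.
Qed.

Definition penrose m n (A : 'M[K]_(m, n)) (X : 'M[K]_(n, m)) : bool :=
  [&& A *m X *m A == A, X *m A *m X == X,
      (A *m X)^H == A *m X & (X *m A)^H == X *m A].

Lemma penrose_exists m n (A : 'M[K]_(m, n)) : exists X, penrose A X.
Proof.
have [r [C [W [AE Cfull /row_freeP[B WB1]]]]] :
    exists r (C : 'M_(m, r)) (W : 'M_(r, n)),
      [/\ A = C *m W, row_full C & row_free W].
  exists (\rank A), (col_base A), (row_base A).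
  by rewrite mulmx_base col_base_full row_base_free.
have Cu : C^H *m C \in unitmx by apply: adjmx_gram_unit.
have Wu : W *m W^H \in unitmx.
  rewrite -{1}[W]adjmxK; apply: adjmx_gram_unit; apply/row_fullP.
  by exists B^H; rewrite -adjmxM WB1 adjmx1.
pose CI := invmx (C^H *m C) *m C^H; pose WI := W^H *m invmx (W *m W^H).
have CIC : CI *m C = 1%:M by rewrite /CI -mulmxA mulVmx.
have WWI : W *m WI = 1%:M by rewrite /WI mulmxA mulmxV.
have AX : A *m (WI *m CI) = C *m CI.
  by rewrite AE -mulmxA (mulmxA W) WWI mul1mx.
have XA : (WI *m CI) *m A = WI *m W.
  by rewrite AE mulmxA -(mulmxA WI CI) CIC mulmx1.
exists (WI *m CI); rewrite /penrose AX XA; apply/and4P; split; apply/eqP.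
- by rewrite {1}AE mulmxA -(mulmxA C) CIC mulmx1 -AE.
- by rewrite mulmxA -(mulmxA WI) WWI mulmx1.
- by rewrite /CI !adjmxM adjmx_inv adjmxM adjmxK !mulmxA.
- by rewrite /WI !adjmxM adjmx_inv adjmxM adjmxK !mulmxA.
Qed.

Lemma penrose_unique m n (A : 'M[K]_(m, n)) X Y :
  penrose A X -> penrose A Y -> X = Y.
Proof.
case/and4P=> /eqP AXA /eqP XAX /eqP AXH /eqP XAH.
case/and4P=> /eqP AYA /eqP YAY /eqP AYH /eqP YAH.
have EA : A *m X = A *m Y.
  by rewrite -AXH -AYH -{1}AYA -(mulmxA (A *m Y)) adjmxM AXH AYH !mulmxA AXA.
have EX : X *m A = Y *m A.
  by rewrite -XAH -YAH -{1}AYA !mulmxA -mulmxA adjmxM XAH YAH -mulmxA (mulmxA A X A) AXA.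
by rewrite -XAX -mulmxA EA mulmxA EX YAY.
Qed.

Definition mpinv m n (A : 'M[K]_(m, n)) : 'M[K]_(n, m) :=
  xchoose (penrose_exists A).
Local Notation "A ^MP" := (mpinv A) : ring_scope.

Lemma mpinvP m n (A : 'M[K]_(m, n)) : penrose A A^MP.
Proof. exact: xchooseP. Qed.

Lemma mpinv_eq m n (A : 'M[K]_(m, n)) X : penrose A X -> A^MP = X.
Proof. exact: penrose_unique (mpinvP A). Qed.

Definition colspace m n (A : 'M[K]_(m, n)) : {vspace 'cV[K]_m} :=
  limg (linfun (mulmx A : 'cV[K]_n -> 'cV[K]_m)).

Lemma colspaceP m n (A : 'M[K]_(m, n)) (v : 'cV[K]_m) :
  reflect (exists w : 'cV[K]_n, v = A *m w) (v \in colspace A).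
Proof.
apply: (iffP memv_imgP) => [[w _ ->]|[w ->]]; exists w; rewrite ?memvf ?lfunE //.
Qed.

Definition orthonormal_cols m n (U : 'M[K]_(m, n)) : Prop := U^H *m U = 1%:M.

Definition unitary n (Q : 'M[K]_n) : Prop :=
  Q^H *m Q = 1%:M /\ Q *m Q^H = 1%:M.

Definition essential_reduced_svd p q r (M : 'M[K]_(p, q))
    (U : 'M[K]_(p, r)) (sigma : 'rV[R]_r) (V : 'M[K]_(q, r)) : Prop :=
  [/\ r = \rank M,
      orthonormal_cols U /\ orthonormal_cols V,
      forall i j : 'I_r, (i <= j)%N -> sigma 0 j <= sigma 0 i,
      forall i : 'I_r, 0 < sigma 0 i
    & M = U *m diag_mx (map_mx (scalar_of_real R F) sigma) *m V^H].

(* [M = [Q 0; 0 0]] with [Q] unitary, after a reordering of the rows and one of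
   the columns: for [M = VA^H *m UB] these index the singular vectors, and the
   ones that carry [Q] need not belong to the largest singular values. Already
   for [A = diag(2, 1)] and [B = (0, 1)^T], where the reverse order law holds,
   the decreasing order of the singular values forces [VA^H *m UB = (0, u)^T]
   with [|u| = 1].
   Any of the zero blocks may be empty; [t = 0] gives the zero matrix. *)
Definition unitary_block p q (M : 'M[K]_(p, q)) : Prop :=
  exists (s1 : 'S_p) (s2 : 'S_q) (t a b : nat)
         (ep : (t + a)%N = p) (eq : (t + b)%N = q) (Q : 'M[K]_t),
    unitary Q /\
    row_perm s1 (col_perm s2 M) = castmx (ep, eq) (block_mx Q 0 0 0).

End Scalar.

Notation "A ^H" := (adjmx A) : ring_scope.
Notation "A ^MP" := (mpinv A) : ring_scope.

(* Main.v *)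
Require Import Defs.
From mathcomp Require Import all_boot all_order all_fingroup all_algebra.
From mathcomp Require Import reals complex.

(** Write [P = A^MP *m A] and [Q = B *m B^MP] for the orthogonal projections
    onto the row space of [A] and the column space of [B], and put
    [H = A^H *m A] and [G = B *m B^H].  Every condition is compared with the
    last one, [P] commutes with [G] and [Q] commutes with [H], called
    [proj_gram_comm] below.  That condition is invariant under the duality
    [(A, B) |-> (B^H, A^H)], which exchanges its two halves, so each implication
    has to be proved for one half only.

    - Reverse order law ([reverse_order_lawP]).  If the law holds, the equation
      [X^MP *m X *m X^H = X^H] for [X = A *m B] gives
      [A G (1 - P) G A^H = 0].  The left-hand side is the Gram matrix of
      [(1 - P) G A^H], so [G] maps the range of [P] into itself and, being
      Hermitian, commutes with [P].  Conversely, the commutation relations make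
      [P] and [Q] commute, and the four Penrose equations follow.
    - Column spaces ([colspace_gramP]).  An inclusion of column spaces is a
      factorization.  As [Q] fixes everything of the form [G *m Z], a
      factorization of [H *m B] through [G] says that [H] preserves the column
      space of [B].
    - The law for [H] and [G] ([proj_gram_comm_gram]).  [H] and [G] have the
      same projections [P] and [Q] but the Gram matrices [H^2] and [G^2]; a
      matrix that commutes with the square of a positive semidefinite matrix
      commutes with that matrix.
    - Singular vectors ([aligned_svdsP]).  If [Q] commutes with [H], the right
      singular vectors of [A] can be chosen among the eigenvectors of [Q]
      ([essential_svd_exists]); likewise the left singular vectors of [B] among
      those of [P].  For such choices, [M = VA^H *m UB] is a partial isometry
      with [M *m M^H] and [M^H *m M] diagonal.  These diagonals consist of zeros
      and ones, and reordering the ones to the front displays the unitary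
      block.  Conversely, a partial isometry satisfies
      [VA *m M = UB *m (M^H *m M)], and a diagonal [M^H *m M] commutes with the
      singular values of [B]. *)

Set Implicit Arguments.
Unset Strict Implicit.
Unset Printing Implicit Defensive.

Import Order.TTheory GRing.Theory Num.Theory.
Local Open Scope ring_scope.

Section ReverseOrderLaw.
Variables (R : realType) (F : base_field).
Local Notation K := (scalars R F).
Local Notation conj := (scalar_conj R F).
Local Notation ofR := (scalar_of_real R F).
Implicit Types m n k p q r : nat.

(** * Moore-Penrose projections *)

Lemma adjmxB m n (A B : 'M[K]_(m, n)) : (A - B)^H = A^H - B^H.
Proof. by rewrite /adjmx linearB map_mxB. Qed.

Lemma mpinvK m n (A : 'M[K]_(m, n)) : A *m A^MP *m A = A.
Proof. by case/and4P: (mpinvP A) => /eqP. Qed.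

Lemma mpinvVK m n (A : 'M[K]_(m, n)) : A^MP *m A *m A^MP = A^MP.
Proof. by case/and4P: (mpinvP A) => _ /eqP. Qed.

Lemma colproj_hermitian m n (A : 'M[K]_(m, n)) : (A *m A^MP)^H = A *m A^MP.
Proof. by case/and4P: (mpinvP A) => _ _ /eqP. Qed.

Lemma rowproj_hermitian m n (A : 'M[K]_(m, n)) : (A^MP *m A)^H = A^MP *m A.
Proof. by case/and4P: (mpinvP A) => _ _ _ /eqP. Qed.

Lemma mpinv_adj m n (A : 'M[K]_(m, n)) : A^H^MP = A^MP^H.
Proof.
apply: mpinv_eq; apply/and4P; split; apply/eqP.
- by rewrite -!adjmxM mulmxA mpinvK.
- by rewrite -!adjmxM mulmxA mpinvVK.
- by rewrite -adjmxM !rowproj_hermitian.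
- by rewrite -adjmxM !colproj_hermitian.
Qed.

Lemma adj_colproj m n (A : 'M[K]_(m, n)) : A^H^MP *m A^H = A *m A^MP.
Proof. by rewrite mpinv_adj -adjmxM colproj_hermitian. Qed.

Lemma adj_rowproj m n (A : 'M[K]_(m, n)) : A^H *m A^H^MP = A^MP *m A.
Proof. by rewrite mpinv_adj -adjmxM rowproj_hermitian. Qed.

Lemma adjmx_mul_colproj m n (A : 'M[K]_(m, n)) : A^H *m (A *m A^MP) = A^H.
Proof. by rewrite -[A *m _]colproj_hermitian -adjmxM mpinvK. Qed.

Lemma rowproj_mul_adj m n (A : 'M[K]_(m, n)) : A^MP *m A *m A^H = A^H.
Proof. by rewrite -[_ *m A]rowproj_hermitian -adjmxM mulmxA mpinvK. Qed.

(** For [P = A^MP *m A] the hypotheses give [P X = P] and [X P = X], and these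
    two are adjoint to each other.  Used to identify [P] for a Gram matrix and
    for a singular value decomposition. *)
Lemma rowproj_unique m n (A : 'M[K]_(m, n)) (X : 'M[K]_n) (Y : 'M[K]_(n, m)) :
  X^H = X -> A *m X = A -> X = Y *m A -> A^MP *m A = X.
Proof.
move=> XH AX XE.
have PX : A^MP *m A *m X = A^MP *m A by rewrite -mulmxA AX.
have XP : X *m (A^MP *m A) = X by rewrite {1}XE -mulmxA (mulmxA A) mpinvK -XE.
by rewrite -rowproj_hermitian -PX adjmxM rowproj_hermitian XH XP.
Qed.

Lemma rowproj_gram m n (A : 'M[K]_(m, n)) :
  (A^H *m A)^MP *m (A^H *m A) = A^MP *m A.
Proof.
apply: (@rowproj_unique _ _ _ _ (A^MP *m A^H^MP)).
- exact: rowproj_hermitian.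
- by rewrite -mulmxA (mulmxA A) mpinvK.
- by rewrite -mulmxA (mulmxA A^H^MP) adj_colproj mpinvK.
Qed.

Lemma hermitian_comm n (P H : 'M[K]_n) :
  P^H = P -> H^H = H -> P *m H *m P = H *m P -> comm_mx P H.
Proof.
move=> PH HH PHP.
by rewrite /comm_mx -[LHS]adjmxK adjmxM PH HH -PHP !adjmxM PH HH mulmxA PHP.
Qed.

Lemma gram_adj m n (A : 'M[K]_(m, n)) : (A^H *m A)^H = A^H *m A.
Proof. by rewrite adjmxM adjmxK. Qed.

Lemma cogram_adj m n (A : 'M[K]_(m, n)) : (A *m A^H)^H = A *m A^H.
Proof. by rewrite adjmxM adjmxK. Qed.

(** The condition through which all the others are linked. *)
Definition proj_gram_comm m n k (A : 'M[K]_(m, n)) (B : 'M[K]_(n, k)) : Prop :=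
  comm_mx (A^MP *m A) (B *m B^H) /\ comm_mx (B *m B^MP) (A^H *m A).

Lemma proj_gram_comm_adj m n k (A : 'M[K]_(m, n)) (B : 'M[K]_(n, k)) :
  proj_gram_comm A B -> proj_gram_comm B^H A^H.
Proof. by case=> PG QH; split; rewrite ?adj_colproj ?adj_rowproj !adjmxK. Qed.

(** The equation [X^MP *m X *m X^H = X^H] for [X = A *m B], multiplied on the
    left by [A *m B *m B^H *m B], reads [A G P G A^H = A G G A^H]: the Gram
    matrix of [(1 - P) G A^H] vanishes. *)
Lemma reverse_order_comm m n k (A : 'M[K]_(m, n)) (B : 'M[K]_(n, k)) :
  (A *m B)^MP = B^MP *m A^MP -> comm_mx (A^MP *m A) (B *m B^H).
Proof.
move=> ABE; set P := A^MP *m A; set G := B *m B^H.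
have PH : P^H = P by exact: rowproj_hermitian.
have GH : G^H = G by exact: cogram_adj.
have PP : P *m P = P by rewrite /P mulmxA mpinvVK.
have E : A *m G *m G *m A^H = A *m G *m P *m G *m A^H.
  have -> : A *m G *m G *m A^H = A *m G *m B *m (A *m B)^H.
    by rewrite adjmxM !mulmxA.
  rewrite -(rowproj_mul_adj (A *m B)) ABE adjmxM /G /P !mulmxA.
  by rewrite -(mulmxA _ B B^MP) -(mulmxA _ B^H (B *m B^MP)) adjmx_mul_colproj.
have GA0 : G *m A^H = P *m (G *m A^H).
  apply/eqP; rewrite -subr_eq0 -adjmx_mul_eq0; apply/eqP.
  rewrite -{1 3}[G *m A^H]mul1mx -mulmxBl adjmxM adjmxM adjmxK GH.
  have CC : (1%:M - P) *m (1%:M - P) = 1%:M - P.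
    by rewrite mulmxBl mul1mx mulmxBr mulmx1 PP subrr subr0.
  rewrite adjmxB adjmx1 PH mulmxA -(mulmxA (A *m G)) CC mulmxBr mulmx1 mulmxBl.
  by apply/eqP; rewrite subr_eq0; move: E; rewrite !mulmxA => ->.
apply: hermitian_comm => //.
have AH : A^H *m (A^MP)^H = P by rewrite -adjmxM rowproj_hermitian.
rewrite -[in RHS]AH [in RHS]mulmxA [in RHS]GA0 -[RHS]mulmxA -(mulmxA G) AH.
by rewrite -mulmxA.
Qed.

Lemma colproj_cogram m n (A : 'M[K]_(m, n)) :
  A *m A^MP = A *m A^H *m (A^MP^H *m A^MP).
Proof.
by rewrite mulmxA -(mulmxA A) -adjmxM rowproj_hermitian -(mulmxA A) mpinvVK.
Qed.

(** [B *m B^MP] is [B *m B^H] times a matrix, so that its range is invariant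
    under whatever commutes with [B *m B^H]. *)
Lemma projs_comm m n k (A : 'M[K]_(m, n)) (B : 'M[K]_(n, k)) :
  comm_mx (A^MP *m A) (B *m B^H) -> comm_mx (B *m B^MP) (A^MP *m A).
Proof.
move=> PG; set P := A^MP *m A in PG *; set Q := B *m B^MP.
have QE : Q = B *m B^H *m (B^MP^H *m B^MP) by exact: colproj_cogram.
have QG : Q *m (B *m B^H) = B *m B^H by rewrite mulmxA mpinvK.
apply/comm_mx_sym/esym/hermitian_comm.
- exact: colproj_hermitian.
- exact: rowproj_hermitian.
rewrite -mulmxA {2}QE (mulmxA P) PG -!(mulmxA (B *m B^H)) mulmxA QG mulmxA.
by rewrite -PG -mulmxA -QE.
Qed.

(** Moving [Q] across [A^H *m A] turns [A Q A^MP] into [(A^MP)^H Q A^H], which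
    is its adjoint. *)
Lemma conj_mpinv_hermitian m n (A : 'M[K]_(m, n)) (Q : 'M[K]_n) :
  Q^H = Q -> comm_mx Q (A^H *m A) -> (A *m Q *m A^MP)^H = A *m Q *m A^MP.
Proof.
move=> QH QA; rewrite 2!adjmxM QH mulmxA -[in LHS](adjmx_mul_colproj A).
rewrite (mulmxA A^H) mulmxA -(mulmxA _ Q) QA !mulmxA -adjmxM colproj_hermitian.
by rewrite mpinvK.
Qed.

Lemma comm_reverse_order m n k (A : 'M[K]_(m, n)) (B : 'M[K]_(n, k)) :
  proj_gram_comm A B -> (A *m B)^MP = B^MP *m A^MP.
Proof.
move=> AB; have [PG QH] := AB; have PQ := projs_comm PG.
have [PG' _] := proj_gram_comm_adj AB.
apply: mpinv_eq; apply/and4P; split; apply/eqP.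
- transitivity (A *m (B *m B^MP *m (A^MP *m A)) *m B); first by rewrite !mulmxA.
  by rewrite PQ !mulmxA mpinvK -!mulmxA (mulmxA B) mpinvK.
- transitivity (B^MP *m (A^MP *m A *m (B *m B^MP)) *m A^MP).
    by rewrite !mulmxA.
  by rewrite -PQ !mulmxA mpinvVK -!mulmxA (mulmxA A^MP) mpinvVK.
- rewrite mulmxA -(mulmxA A); apply: conj_mpinv_hermitian => //.
  exact: colproj_hermitian.
have E : (B^MP *m A^MP *m (A *m B))^H = B^H *m (A^MP *m A) *m B^H^MP.
  by rewrite mulmxA -(mulmxA B^MP) 2!adjmxM rowproj_hermitian mpinv_adj !mulmxA.
(* The right-hand side of [E] is the form treated by [conj_mpinv_hermitian],
   for the dual pair. *)
rewrite E -[RHS]adjmxK E conj_mpinv_hermitian //.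
  exact: rowproj_hermitian.
by rewrite adjmxK.
Qed.

Lemma reverse_order_lawP m n k (A : 'M[K]_(m, n)) (B : 'M[K]_(n, k)) :
  (A *m B)^MP = B^MP *m A^MP <-> proj_gram_comm A B.
Proof.
split=> [ABE|]; last exact: comm_reverse_order.
split; first exact: reverse_order_comm.
rewrite -adj_colproj -{2}[A]adjmxK; apply: reverse_order_comm.
by rewrite -adjmxM !mpinv_adj ABE adjmxM.
Qed.

Lemma colspace_subP m n k (A : 'M[K]_(m, n)) (B : 'M[K]_(m, k)) :
  (colspace A <= colspace B)%VS <-> exists X, A = B *m X.
Proof.
split=> [AB | [X ->]]; last first.
  apply/subvP => v /colspaceP[w ->]; apply/colspaceP.
  by exists (X *m w); rewrite mulmxA.
have cols j : exists w, col j A = B *m w.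
  by apply/colspaceP/(subvP AB)/colspaceP; exists (delta_mx j 0); rewrite colE.
have [w wE] := fin_all_exists cols.
exists (\matrix_(i, j) w j i 0); apply/matrixP => i j.
have /colP/(_ i) := wE j; rewrite !mxE => ->.
by apply: eq_bigr => l _; rewrite mxE.
Qed.

(** [Q] fixes the columns of [B *m B^H], so the hypothesis yields
    [Q H B = H B], and hence [Q H Q = H Q]. *)
Lemma gram_factor_comm m n k (A : 'M[K]_(m, n)) (B : 'M[K]_(n, k)) X :
  A^H *m A *m B = B *m B^H *m A^H *m X -> comm_mx (B *m B^MP) (A^H *m A).
Proof.
move=> HB; apply: hermitian_comm.
- exact: colproj_hermitian.
- exact: gram_adj.
have QHB : B *m B^MP *m (A^H *m A *m B) = A^H *m A *m B.
  by rewrite HB !mulmxA mpinvK.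
by rewrite -mulmxA (mulmxA (A^H *m A)) mulmxA QHB.
Qed.

(** With [Q] and [P] moved to the left, [H B = Q P H B]; then [Q P = P Q], where
    [Q] factors through [G], and [P G = G P] brings [G A^H] to the front. *)
Lemma gram_mul_factor m n k (A : 'M[K]_(m, n)) (B : 'M[K]_(n, k)) :
  proj_gram_comm A B -> exists X, A^H *m A *m B = B *m B^H *m A^H *m X.
Proof.
case=> PG QH; have PQ := projs_comm PG.
exists (A^H^MP *m (B^MP^H *m B^MP) *m (A^H *m A) *m B).
transitivity (B *m B^MP *m (A^MP *m A) *m (A^H *m A) *m B).
  rewrite -(mulmxA _ (A^MP *m A)) (mulmxA _ A^H) rowproj_mul_adj QH.
  by rewrite -[RHS]mulmxA mpinvK.
rewrite PQ colproj_cogram (mulmxA (A^MP *m A)) PG -adj_rowproj.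
by rewrite !mulmxA.
Qed.

Lemma colspace_gramP m n k (A : 'M[K]_(m, n)) (B : 'M[K]_(n, k)) :
  colspace (A^H *m A *m B) = colspace (B *m B^H *m A^H) <-> proj_gram_comm A B.
Proof.
split=> [AB | AB].
  have [X XE] : exists X, A^H *m A *m B = B *m B^H *m A^H *m X.
    by apply/colspace_subP; rewrite AB.
  have [Y YE] : exists Y, B *m B^H *m A^H = A^H *m A *m B *m Y.
    by apply/colspace_subP; rewrite AB.
  split; last exact: gram_factor_comm XE.
  have := @gram_factor_comm _ _ _ B^H A^H Y.
  by rewrite adj_rowproj !adjmxK; apply.
apply/eqP; rewrite eqEsubv; apply/andP; split; apply/colspace_subP.
  exact: gram_mul_factor.
by have := gram_mul_factor (proj_gram_comm_adj AB); rewrite !adjmxK.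
Qed.

(** * Eigenvectors of Hermitian matrices over both fields *)

Lemma conj_ofR x : conj (ofR x) = ofR x.
Proof. by case: F => //=; rewrite oppr0. Qed.

Lemma ge0_ofR (x : K) : 0 <= x -> exists y, x = ofR y.
Proof.
case: F x => /= x; first by exists x.
by move=> /ger0_real/complex_realP.
Qed.

Lemma ofR_ge0 x : (0 <= ofR x) = (0 <= x).
Proof. by case: F => //=; rewrite lecR. Qed.

Lemma adjmxZ m n (a : K) (A : 'M[K]_(m, n)) : (a *: A)^H = conj a *: A^H.
Proof. by rewrite /adjmx linearZ map_mxZ. Qed.

(** A unitarily diagonalizable matrix whose diagonal form is zero is zero. *)
Lemma complex_hermitian_eigenvalue n (T : 'M[R[i]]_n) :
  map_mx (@conjc R) T^T = T -> T != 0 ->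
  exists2 x : R, x != 0 & eigenvalue T (real_complex R x).
Proof.
move=> Th Tn0.
have Th' : T \is hermsymmx.
  apply/is_hermitianmxP; rewrite expr0 scale1r -[LHS]Th.
  by apply/matrixP=> i j; rewrite !mxE.
have /orthomx_spectralP TE := hermitian_normalmx Th'.
have /mxOverP Dreal := hermitian_spectral_diag_real Th'.
have Pu := spectral_unit T.
set P := spectralmx T in TE Pu; set d := spectral_diag T in TE Dreal.
have [i di] : exists i, d 0 i != 0.
  apply/existsP; apply: contraNT Tn0; rewrite negb_exists => /forallP d0.
  have d_eq0 : d = 0 by apply/rowP => i; rewrite mxE; apply/eqP/negPn/d0.
  by rewrite TE d_eq0 linear0 mulmx0 mul0mx.
have /complex_realP[x dx] := Dreal 0 i.
exists x; first by apply: contraNneq di => x0; rewrite dx x0.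
apply/eigenvalueP; exists (row i P).
  rewrite -row_mul TE !mulmxA mulmxV // mul1mx row_mul row_diag_mx.
  by rewrite -scalemxAl -rowE dx.
apply: contraTneq Pu => Pi0; rewrite -row_free_unit -kermx_eq0.
apply/rowV0Pn; exists (delta_mx 0 i); last first.
  by apply/eqP => /rowP/(_ i)/eqP; rewrite !mxE !eqxx oner_eq0.
by apply/sub_kermxP; rewrite -rowE.
Qed.

(** Over the reals the eigenvalue is found by complexification: it is real, so
    the characteristic equation already holds before extending scalars. *)
Lemma hermitian_eigenvector n (T : 'M[K]_n) : T^H = T -> T != 0 ->
  exists2 x : R, x != 0 & exists2 v : 'cV[K]_n, v != 0 & T *m v = ofR x *: v.
Proof.
move=> Th Tn0.
have [x xn0 /eigenvalueP[u uT un0]] :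
    exists2 x : R, x != 0 & eigenvalue T (ofR x).
  case: F T Th Tn0 => /= T Th Tn0; last exact: complex_hermitian_eigenvalue.
  have [||x xn0] := @complex_hermitian_eigenvalue _ (map_mx (real_complex R) T).
  - apply/matrixP=> i j; rewrite !mxE /= oppr0.
    by move/matrixP: Th => /(_ i j); rewrite !mxE /= => ->.
  - by rewrite map_mx_eq0.
  by rewrite eigenvalue_map; exists x.
exists x => //; exists u^H.
  by apply: contraNneq un0 => u0; rewrite -[u]adjmxK u0 adjmx0.
by rewrite -[in LHS]Th -adjmxM uT adjmxZ conj_ofR.
Qed.

Lemma gram_ge0 m (v : 'cV[K]_m) : 0 <= (v^H *m v) 0 0.
Proof.
by rewrite mxE sumr_ge0 // => i _; rewrite !mxE scalar_mul_conj exprn_ge0.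
Qed.

Lemma gram_col_gt0 n (v : 'cV[K]_n) : v != 0 ->
  exists2 c : R, 0 < c & v^H *m v = (ofR c)%:M.
Proof.
move=> vn0; have [c cE] : exists c, (v^H *m v) 0 0 = ofR c.
  exact/ge0_ofR/gram_ge0.
have vvE : v^H *m v = (ofR c)%:M.
  by apply/matrixP => i j; rewrite !ord1 cE mxE eqxx.
exists c => //; rewrite lt_neqAle; apply/andP; split.
  apply: contraNneq vn0 => c0; rewrite -adjmx_mul_eq0 vvE -c0 rmorph0.
  by rewrite raddf0.
by rewrite -ofR_ge0 -cE gram_ge0.
Qed.

(** If [Q *m H] is nonzero, it is Hermitian, and its eigenvectors for nonzero
    eigenvalues lie in the range of [Q], where [Q *m H] and [H] agree.
    Otherwise every eigenvector of [H] for a nonzero eigenvalue is killed by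
    [Q]. *)
Lemma common_unit_eigenvector n (H Q : 'M[K]_n) :
  H^H = H -> Q^H = Q -> Q *m Q = Q -> comm_mx Q H -> H != 0 ->
  exists (x q : R) (v : 'cV[K]_n),
    [/\ x != 0, v^H *m v = 1%:M, H *m v = ofR x *: v & Q *m v = ofR q *: v].
Proof.
move=> Hh Qh QQ QH Hn0.
have [x [q [v [xn0 vn0 Hv Qv]]]] : exists (x q : R) (v : 'cV[K]_n),
    [/\ x != 0, v != 0, H *m v = ofR x *: v & Q *m v = ofR q *: v].
  have ofRn0 y : y != 0 -> ofR y != 0 by rewrite fmorph_eq0.
  have [QH0 | QHn0] := eqVneq (Q *m H) 0.
    have [x xn0 [v vn0 Hv]] := hermitian_eigenvector Hh Hn0.
    exists x, 0, v; split=> //; rewrite rmorph0 scale0r.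
    apply: (scalerI (ofRn0 _ xn0)).
    by rewrite scaler0 scalemxAr -Hv mulmxA QH0 mul0mx.
  have [|x xn0 [v vn0 QHv]] := hermitian_eigenvector _ QHn0.
    by rewrite adjmxM Hh Qh QH.
  have Qv : Q *m v = v.
    apply: (scalerI (ofRn0 _ xn0)).
    by rewrite scalemxAr -QHv mulmxA mulmxA QQ.
  exists x, 1, v; split=> //; last by rewrite rmorph1 scale1r.
  by rewrite -QHv QH -mulmxA Qv.
have [c cgt0 cE] := gram_col_gt0 vn0.
pose a := (Num.sqrt c)^-1.
exists x, q, (ofR a *: v); split=> //.
- rewrite adjmxZ conj_ofR -scalemxAl -scalemxAr cE scalerA -rmorphM.
  rewrite scale_scalar_mx -rmorphM /a -invfM -expr2 sqr_sqrtr ?ltW //.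
  by rewrite mulVf ?rmorph1 // gt_eqF.
- by rewrite -scalemxAr Hv scalerA mulrC -scalerA.
- by rewrite -scalemxAr Qv scalerA mulrC -scalerA.
Qed.

(** * Singular value decompositions adapted to a projection *)

Lemma adjmx_row m n1 n2 (A : 'M[K]_(m, n1)) (B : 'M[K]_(m, n2)) :
  (row_mx A B)^H = col_mx A^H B^H.
Proof. by rewrite /adjmx tr_row_mx map_col_mx. Qed.

(** The matrix [Sigma] of a singular value decomposition. *)
Definition rdiag r (s : 'rV[R]_r) : 'M[K]_r := diag_mx (map_mx ofR s).

Lemma rdiag_row r1 r2 (s1 : 'rV[R]_r1) (s2 : 'rV[R]_r2) :
  rdiag (row_mx s1 s2) = block_mx (rdiag s1) 0 0 (rdiag s2).
Proof. by rewrite /rdiag map_row_mx diag_mx_row. Qed.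

Lemma rdiag_const (x : R) : rdiag (x%:M : 'rV_1) = (ofR x)%:M.
Proof. by apply/matrixP => i j; rewrite !ord1 !mxE !eqxx. Qed.

Lemma adjmx_rdiag r (s : 'rV[R]_r) : (rdiag s)^H = rdiag s.
Proof.
apply/matrixP => i j; rewrite !mxE eq_sym.
by case: eqP => [->|_]; rewrite ?mulr1n ?conj_ofR ?mulr0n ?rmorph0.
Qed.

Lemma rdiag_unit r (s : 'rV[R]_r) : (forall i, 0 < s 0 i) -> rdiag s \in unitmx.
Proof.
move=> s_gt0; rewrite unitmxE det_diag unitfE; apply/prodf_neq0 => i _.
by rewrite mxE fmorph_eq0 gt_eqF.
Qed.

(** Deflation: for a common unit eigenvector [v] of [A^H *m A] and [Q], the
    matrix [A *m E] with [E = 1%:M - v *m v^H] has smaller rank, and [Q] still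
    commutes with its Gram matrix [E *m (A^H *m A) *m E].  Its singular vectors
    are orthogonal to [v] and [A *m v], so that one more singular triple
    completes the decomposition. *)
Lemma adapted_svd n (Q : 'M[K]_n) m (A : 'M[K]_(m, n)) :
    Q^H = Q -> Q *m Q = Q -> comm_mx Q (A^H *m A) ->
  exists r (U : 'M[K]_(m, r)) (s : 'rV[R]_r) (V : 'M[K]_(n, r)) (q : 'rV[R]_r),
    [/\ U^H *m U = 1%:M /\ V^H *m V = 1%:M, forall i, 0 < s 0 i,
        A = U *m rdiag s *m V^H & Q *m V = V *m rdiag q].
Proof.
move=> Qh QQ; have [N] := ubnP (\rank A); elim: N A => // N IH A rkA QA.
have [A0 | An0] := eqVneq A 0.
  exists 0%N, 0, 0, 0, 0; split; try by rewrite ?mul0mx ?mulmx0.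
    by split; apply/matrixP => [[]].
  by case.
have [x [q [v [xn0 vv Hv Qv]]]] := common_unit_eigenvector (gram_adj A) Qh QQ QA
  (eq_ind_r (fun b => ~~ b) An0 (adjmx_mul_eq0 A)).
have vAAv : (A *m v)^H *m (A *m v) = (ofR x)%:M.
  by rewrite adjmxM -mulmxA (mulmxA A^H) Hv -scalemxAr vv scale_scalar_mx mulr1.
have x_gt0 : 0 < x.
  rewrite lt_neqAle eq_sym xn0 -ofR_ge0 /=.
  by have := gram_ge0 (A *m v); rewrite vAAv mxE eqxx.
pose sg := Num.sqrt x; have sg_gt0 : 0 < sg by rewrite sqrtr_gt0.
have sgn0 : ofR sg != 0 by rewrite fmorph_eq0 gt_eqF.
pose u := (ofR sg)^-1 *: (A *m v).
have Av : A *m v = ofR sg *: u by rewrite scalerA mulfV ?scale1r.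
have uu : u^H *m u = 1%:M.
  rewrite adjmxZ -scalemxAl -scalemxAr vAAv scalerA fmorphV conj_ofR.
  rewrite scale_scalar_mx -(sqr_sqrtr (ltW x_gt0)) -/sg rmorphXn expr2 /=.
  by rewrite mulrA mulfVK // mulVf.
pose E := 1%:M - v *m v^H.
have Eh : E^H = E by rewrite adjmxB adjmx1 adjmxM adjmxK.
have Ev : E *m v = 0 by rewrite mulmxBl mul1mx -mulmxA vv mulmx1 subrr.
have vE : v^H *m E = 0 by rewrite mulmxBr mulmx1 mulmxA vv mul1mx subrr.
have vH : v^H *m (A^H *m A) = ofR x *: v^H.
  by rewrite -[_ *m A]gram_adj -adjmxM Hv adjmxZ conj_ofR.
have AEv : A *m E *m v = 0 by rewrite -mulmxA Ev mulmx0.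
have uAE : u^H *m (A *m E) = 0.
  rewrite adjmxZ adjmxM -scalemxAl mulmxA -(mulmxA v^H) vH -!scalemxAl vE.
  by rewrite !scaler0.
have QE : comm_mx Q E.
  rewrite /comm_mx mulmxBl mulmxBr mulmx1 mul1mx mulmxA Qv -(mulmxA v).
  rewrite -[v^H *m Q]adjmxK adjmxM Qh adjmxK Qv adjmxZ conj_ofR.
  by rewrite -scalemxAl -scalemxAr.
(* The rows of [A *m E] lie in the row space of [A] since [v^H] does; the
   inclusion is strict because [A *m E] kills [v] and [A] does not. *)
have rkAE : (\rank (A *m E) < N)%N.
  rewrite ltnS in rkA; apply: leq_trans rkA; apply: rank_ltmx; rewrite ltmxE.
  apply/andP; split.
    rewrite mulmxBr mulmx1 addmx_sub // eqmx_opp mulmxA mulmx_sub //.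
    have -> : v^H = (ofR x)^-1 *: (v^H *m A^H *m A).
      by rewrite -mulmxA vH scalerA mulVf ?scale1r // fmorph_eq0.
    by rewrite scalemx_sub // submxMl.
  apply/negP => /submxP[X AX].
  have : A *m v = 0 by rewrite AX -mulmxA AEv mulmx0.
  move=> Av0; move: vAAv; rewrite Av0 mulmx0 => /matrixP/(_ 0 0)/esym/eqP.
  by rewrite !mxE fmorph_eq0 (negPf xn0).
have [|r [U [s [V [p [[UU VV] s_gt0 AE QV]]]]]] := IH (A *m E) rkAE.
  rewrite adjmxM Eh -mulmxA (mulmxA A^H).
  by apply: comm_mxM => //; apply: comm_mxM.
have Du := rdiag_unit s_gt0.
have Vv : V^H *m v = 0.
  have := AEv; rewrite AE => /(congr1 (mulmx (invmx (rdiag s) *m U^H))).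
  by rewrite mulmx0 !mulmxA -(mulmxA _ U^H) UU mulmx1 mulVmx // mul1mx.
have uU : u^H *m U = 0.
  have := uAE; rewrite AE => /(congr1 (mulmx^~ (V *m invmx (rdiag s)))).
  by rewrite mul0mx !mulmxA -(mulmxA _ V^H) VV mulmx1 mulmxK.
have vV : v^H *m V = 0 by rewrite -[LHS]adjmxK adjmxM adjmxK Vv adjmx0.
have Uu : U^H *m u = 0 by rewrite -[LHS]adjmxK adjmxM adjmxK uU adjmx0.
exists (1 + r)%N, (row_mx u U), (row_mx sg%:M s), (row_mx v V), (row_mx q%:M p).
rewrite !adjmx_row !mul_col_row uu uU Uu UU vv vV Vv VV -scalar_mx_block.
rewrite !rdiag_row !rdiag_const !mul_row_block !mulmx0 !add0r !addr0.
rewrite mul_row_col mul_mx_row Qv QV !mul_mx_scalar; split=> //.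
  move=> i; rewrite mxE; case: split => j; last exact: s_gt0.
  by rewrite ord1 mxE eqxx.
by rewrite -AE -Av mulmxBr mulmx1 -mulmxA addrC subrK.
Qed.

Lemma svd_rank p q r (M : 'M[K]_(p, q)) (U : 'M[K]_(p, r)) (s : 'rV[R]_r)
    (V : 'M[K]_(q, r)) :
  U^H *m U = 1%:M -> V^H *m V = 1%:M -> (forall i, 0 < s 0 i) ->
  M = U *m rdiag s *m V^H -> \rank M = r.
Proof.
move=> UU VV s_gt0 ME; apply/eqP; rewrite eqn_leq; apply/andP; split.
  by rewrite ME -mulmxA (leq_trans (mxrankM_maxl _ _)) // rank_leq_col.
have DE : rdiag s = U^H *m (M *m V).
  by rewrite ME -mulmxA VV mulmx1 mulmxA UU mul1mx.
rewrite -{1}(mxrank_unit (rdiag_unit s_gt0)) DE.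
by rewrite (leq_trans (mxrankM_maxr _ _)) // mxrankM_maxl.
Qed.

Lemma sorting_perm r (s : 'I_r -> R) :
  exists p : 'S_r, forall i j : 'I_r, (i <= j)%N -> s (p j) <= s (p i).
Proof.
pose leT (i j : 'I_r) := s j <= s i.
have leT_total : total leT by move=> i j; rewrite /leT le_total.
have leT_trans : transitive leT by move=> j i k ij jk; apply: le_trans ij.
have /tuple_permP[p pE] : perm_eq (sort leT (enum 'I_r)) (ord_tuple r).
  by rewrite perm_sort.
exists p => i j ij; rewrite -/(leT _ _).
have nthE (x0 k : 'I_r) : nth x0 (sort leT (enum 'I_r)) k = p k.
  by rewrite pE -(tnth_nth _ [tuple of _]) tnth_mktuple tnth_ord_tuple.
rewrite -!(nthE i).
have leT_refl : reflexive leT by move=> k; rewrite /leT.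
apply: (sorted_leq_nth leT_trans leT_refl) => //; first exact: sort_sorted.
  by rewrite inE size_sort size_enum_ord.
by rewrite inE size_sort size_enum_ord.
Qed.

(** Sorting the singular values of an adapted decomposition permutes the columns
    of [V] and keeps them eigenvectors of [Q]. *)
Lemma essential_svd_exists m n (A : 'M[K]_(m, n)) (Q : 'M[K]_n) :
    Q^H = Q -> Q *m Q = Q -> comm_mx Q (A^H *m A) ->
  exists r (U : 'M[K]_(m, r)) (s : 'rV[R]_r) (V : 'M[K]_(n, r)) (q : 'rV[R]_r),
    essential_reduced_svd A U s V /\ Q *m V = V *m rdiag q.
Proof.
move=> Qh QQ QA.
have [r [U [s [V [q [[UU VV] s_gt0 AE QV]]]]]] := adapted_svd Qh QQ QA.
have [p p_sorted] := sorting_perm (s 0).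
have gram_perm k (W : 'M[K]_(k, r)) :
    W^H *m W = 1%:M -> (col_perm p W)^H *m col_perm p W = 1%:M.
  move=> WW; apply/matrixP => i j; have /matrixP/(_ (p i) (p j)) := WW.
  rewrite !mxE (inj_eq perm_inj) => <-.
  by apply: eq_bigr => l _; rewrite !mxE.
exists r, (col_perm p U), (col_perm p s), (col_perm p V), (col_perm p q).
split; last first.
  apply/matrixP => i j; have /matrixP/(_ i (p j)) := QV.
  rewrite !mul_mx_diag !mxE => <-.
  by apply: eq_bigr => l _; rewrite !mxE.
split.
- by rewrite (svd_rank UU VV s_gt0 AE).
- by split; apply: gram_perm.
- by move=> i j ij; rewrite !mxE p_sorted.
- by move=> i; rewrite mxE.
rewrite [LHS]AE; apply/matrixP => i j; rewrite !mul_mx_diag !mxE.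
rewrite (reindex_inj (@perm_inj _ p)) /=.
by apply: eq_bigr => l _; rewrite !mxE.
Qed.

Lemma svd_rowproj m n r (A : 'M[K]_(m, n)) U (s : 'rV[R]_r) (V : 'M[K]_(n, r)) :
  essential_reduced_svd A U s V -> A^MP *m A = V *m V^H.
Proof.
case=> _ [UU VV] _ s_gt0 AE; rewrite -/(rdiag s) in AE.
have Du := rdiag_unit s_gt0.
apply: (@rowproj_unique _ _ _ _ (V *m invmx (rdiag s) *m U^H)).
- by rewrite adjmxM adjmxK.
- by rewrite [in LHS]AE !mulmxA -(mulmxA _ V^H) VV mulmx1 -AE.
- rewrite AE !mulmxA -(mulmxA _ U^H) UU mulmx1 -(mulmxA V) mulVmx //.
  by rewrite mulmx1.
Qed.

Lemma svd_adj m n r (A : 'M[K]_(m, n)) U (s : 'rV[R]_r) (V : 'M[K]_(n, r)) :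
  essential_reduced_svd A U s V -> essential_reduced_svd A^H V s U.
Proof.
case=> rE [UU VV] s_sorted s_gt0 AE; rewrite -/(rdiag s) in AE.
split=> //; last by rewrite AE 2!adjmxM adjmxK adjmx_rdiag mulmxA.
by rewrite rE /adjmx mxrank_map mxrank_tr.
Qed.

Lemma svd_gram m n r (A : 'M[K]_(m, n)) U (s : 'rV[R]_r) (V : 'M[K]_(n, r)) :
  essential_reduced_svd A U s V ->
  A^H *m A = V *m (rdiag s *m rdiag s) *m V^H.
Proof.
case=> _ [UU _] _ _ AE; rewrite -/(rdiag s) in AE.
rewrite AE 2!adjmxM adjmxK adjmx_rdiag !mulmxA -(mulmxA _ U^H) UU mulmx1.
by [].
Qed.

(** * Partial isometries with diagonal Gram matrices *)

Lemma filter_first_perm p (f : pred 'I_p) :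
  exists t a (e : (t + a)%N = p) (s : 'S_p),
    (forall i, f (s (cast_ord e (lshift a i)))) /\
    (forall i, ~~ f (s (cast_ord e (rshift t i)))).
Proof.
pose l := filter f (enum 'I_p) ++ filter (predC f) (enum 'I_p).
have lP : perm_eq l (ord_tuple p) by rewrite perm_filterC.
have /tuple_permP[s sE] := lP.
pose t := size (filter f (enum 'I_p)).
pose a := size (filter (predC f) (enum 'I_p)).
have e : (t + a)%N = p.
  by rewrite -size_cat -[LHS]/(size l) (perm_size lP) size_tuple.
have nthE (x0 k : 'I_p) : nth x0 l k = s k.
  by rewrite sE -(tnth_nth _ [tuple of _]) tnth_mktuple tnth_ord_tuple.
exists t, a, e, s; split=> i.
  rewrite -(nthE (s (cast_ord e (lshift a i)))) /= nth_cat ltn_ord.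
  have := mem_nth (s (cast_ord e (lshift a i))) (ltn_ord i).
  by rewrite mem_filter => /andP[].
rewrite -(nthE (s (cast_ord e (rshift t i)))) /= nth_cat ltnNge leq_addr /=.
rewrite addKn; have := mem_nth (s (cast_ord e (rshift t i))) (ltn_ord i).
by rewrite mem_filter => /andP[].
Qed.

(** A description of [unitary_block] free of permutations and of dependent
    casts. *)
Definition diag_partial_isometry p q (M : 'M[K]_(p, q)) : Prop :=
  [/\ M *m M^H *m M = M, is_diag_mx (M *m M^H) & is_diag_mx (M^H *m M)].

Lemma adjmx_block p1 p2 q1 q2 (A : 'M[K]_(p1, q1)) (B : 'M_(p1, q2))
    (C : 'M_(p2, q1)) (D : 'M_(p2, q2)) :
  (block_mx A B C D)^H = block_mx A^H C^H B^H D^H.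
Proof. by rewrite /adjmx tr_block_mx map_block_mx. Qed.

Lemma adjmx_perm p (s : 'S_p) : (perm_mx s : 'M[K]_p)^H = perm_mx s^-1.
Proof. by rewrite /adjmx tr_perm_mx map_perm_mx. Qed.

Lemma perm_mxK p (s : 'S_p) : perm_mx s^-1 *m perm_mx s = 1%:M :> 'M[K]_p.
Proof. by rewrite -perm_mxM mulVg perm_mx1. Qed.

Lemma is_diag_perm p (s : 'S_p) (D : 'M[K]_p) :
  is_diag_mx D -> is_diag_mx (perm_mx s *m D *m perm_mx s^-1).
Proof.
move=> /is_diag_mxP Dd; rewrite -row_permE -col_permE.
apply/is_diag_mxP => i j ij; rewrite !mxE Dd //.
by rewrite val_eqE (inj_eq perm_inj).
Qed.

Lemma diag_partial_isometry_perm p q (M : 'M[K]_(p, q)) s1 s2 :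
  diag_partial_isometry M ->
  diag_partial_isometry (row_perm s1 (col_perm s2 M)).
Proof.
case=> MMM d1 d2; rewrite row_permE col_permE.
set N := _ *m _.
have NE : N^H = perm_mx s2 *m M^H *m perm_mx s1^-1.
  by rewrite /N 2!adjmxM !adjmx_perm invgK.
have N1 : N *m N^H = perm_mx s1 *m (M *m M^H) *m perm_mx s1^-1.
  by rewrite NE /N !mulmxA -(mulmxA _ (perm_mx s2^-1)) perm_mxK mulmx1.
have N2 : N^H *m N = perm_mx s2 *m (M^H *m M) *m perm_mx s2^-1.
  by rewrite NE /N !mulmxA -(mulmxA _ (perm_mx s1^-1)) perm_mxK mulmx1.
split; rewrite ?N1 ?N2; [| exact: is_diag_perm | exact: is_diag_perm].
rewrite /N -!mulmxA (mulmxA (perm_mx s1^-1)) perm_mxK mul1mx !mulmxA.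
by rewrite -2!(mulmxA (perm_mx s1)) MMM.
Qed.

Lemma unitary_block_isometry p q (M : 'M[K]_(p, q)) :
  unitary_block M -> diag_partial_isometry M.
Proof.
case=> s1 [s2 [t [a [b [ep [eq [Q [[QQ1 QQ2] ME]]]]]]]].
have -> : M = row_perm s1^-1
                (col_perm s2^-1 (castmx (ep, eq) (block_mx Q 0 0 0))).
  by rewrite -ME; apply/matrixP => i j; rewrite !mxE !permKV.
apply: diag_partial_isometry_perm; clear ME M s1 s2.
case: p / ep; case: q / eq; rewrite castmx_id.
rewrite /diag_partial_isometry adjmx_block !adjmx0 !mulmx_block.
rewrite !mulmx0 !mul0mx !addr0 QQ1 QQ2 mul1mx mul0mx; split=> //;
  rewrite is_diag_block_mx // !eqxx /=.
  by rewrite scalar_mx_is_diag mx0_is_diag.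
by rewrite scalar_mx_is_diag mx0_is_diag.
Qed.

Lemma fixed_entry_eq0 (d x : K) : d * x = x -> d != 1 -> x = 0.
Proof.
move=> dx d1; apply/eqP; move/eqP: dx; rewrite -subr_eq0 -{2}[x]mul1r -mulrBl.
by rewrite mulf_eq0 subr_eq0 (negPf d1).
Qed.

(** As [M = (M *m M^H) *m M] with [M *m M^H] diagonal, a row of [M] vanishes
    unless the corresponding diagonal entry is [1]; the same goes for columns.
    The rows and columns that survive form a matrix whose rows and columns are
    both orthonormal, which forces it to be square. *)
Lemma isometry_unitary_block p q (M : 'M[K]_(p, q)) :
  diag_partial_isometry M -> unitary_block M.
Proof.
case=> MMM d1 d2.
have [t [a [ep [s1 [r1 r0]]]]] :=
  filter_first_perm (fun i => (M *m M^H) i i == 1).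
have [t' [b [eq [s2 [c1 c0]]]]] :=
  filter_first_perm (fun j => (M^H *m M) j j == 1).
have row0 i j : (M *m M^H) i i != 1 -> M i j = 0.
  have /diag_mxP[D DE] := d1; rewrite DE mxE eqxx mulr1n.
  apply: fixed_entry_eq0; have /matrixP/(_ i j) := MMM.
  by rewrite DE mul_diag_mx mxE.
have col0 i j : (M^H *m M) j j != 1 -> M i j = 0.
  have /diag_mxP[D DE] := d2; rewrite DE mxE eqxx mulr1n.
  apply: fixed_entry_eq0; have /matrixP/(_ i j) := MMM.
  by rewrite -mulmxA DE mul_mx_diag mxE mulrC.
have d1' := is_diag_mxP d1; have d2' := is_diag_mxP d2.
subst p q.
pose N := row_perm s1 (col_perm s2 M).
have NN1 i j : (N *m N^H) i j = (M *m M^H) (s1 i) (s1 j).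
  rewrite !mxE [RHS](reindex_inj (@perm_inj _ s2)).
  by apply: eq_bigr => l _; rewrite !mxE.
have NN2 i j : (N^H *m N) i j = (M^H *m M) (s2 i) (s2 j).
  rewrite !mxE [RHS](reindex_inj (@perm_inj _ s1)).
  by apply: eq_bigr => l _; rewrite !mxE.
have NE : N = block_mx (ulsubmx N) 0 0 0.
  rewrite -[LHS]submxK; congr block_mx; apply/matrixP => i j; rewrite !mxE.
  - by apply: col0; have := c0 j; rewrite cast_ord_id.
  - by apply: row0; have := r0 i; rewrite cast_ord_id.
  - by apply: row0; have := r0 i; rewrite cast_ord_id.
set X := ulsubmx N in NE.
have XX1 : X *m X^H = 1%:M.
  have -> : X *m X^H = ulsubmx (N *m N^H).
    by rewrite NE adjmx_block !adjmx0 mulmx_block !mulmx0 addr0 block_mxKul.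
  apply/matrixP => i j; rewrite [RHS]mxE [LHS]mxE [LHS]mxE NN1.
  case: eqVneq => [-> | ij]; first by have /eqP := r1 j; rewrite cast_ord_id.
  by rewrite d1' // val_eqE (inj_eq perm_inj) (inj_eq (@lshift_inj _ _)).
have XX2 : X^H *m X = 1%:M.
  have -> : X^H *m X = ulsubmx (N^H *m N).
    by rewrite NE adjmx_block !adjmx0 mulmx_block !mulmx0 addr0 block_mxKul.
  apply/matrixP => i j; rewrite [RHS]mxE [LHS]mxE [LHS]mxE NN2.
  case: eqVneq => [-> | ij]; first by have /eqP := c1 j; rewrite cast_ord_id.
  by rewrite d2' // val_eqE (inj_eq perm_inj) (inj_eq (@lshift_inj _ _)).
have tt' : t = t'.
  by apply/eqP; rewrite eqn_leq (mulmx1_min XX1) (mulmx1_min XX2).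
(* [t'] occurs in the types of [M] and [s2], which are generalized before it is
   replaced by [t]. *)
clearbody X; clear c1 c0 r1 r0 NN1 NN2 MMM d1 d2 d1' d2' row0 col0.
move: s2 M @N X NE XX1 XX2.
case: t' / tt' => s2 M N X NE XX1 XX2.
exists s1, s2, t, a, b, erefl, erefl, X; split; first by split.
by rewrite castmx_id -/N NE.
Qed.

(** The Gram matrix of [V M - W M^H M] is
    [M^H M - 2 M^H M M^H M + M^H M M^H M], which is zero since
    [M M^H M = M]. *)
Lemma isometry_align n r1 r2 (V : 'M[K]_(n, r1)) (W : 'M[K]_(n, r2)) :
    V^H *m V = 1%:M -> W^H *m W = 1%:M ->
    (V^H *m W) *m (V^H *m W)^H *m (V^H *m W) = V^H *m W ->
  V *m (V^H *m W) = W *m ((V^H *m W)^H *m (V^H *m W)).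
Proof.
move ME: (V^H *m W) => M VV WW MMM.
have MhE : M^H = W^H *m V by rewrite -ME adjmxM adjmxK.
have MhM : M^H *m M *m M^H *m M = M^H *m M by rewrite -!mulmxA (mulmxA M) MMM.
apply/eqP; rewrite -subr_eq0 -adjmx_mul_eq0; apply/eqP.
rewrite adjmxB mulmxBl !mulmxBr !adjmxM !adjmxK !mulmxA.
rewrite -(mulmxA _ V^H V) VV mulmx1 -(mulmxA _ W^H W) WW mulmx1.
rewrite -(mulmxA _ V^H W) ME -(mulmxA _ W^H V) -MhE.
by rewrite !MhM !subrr.
Qed.

(** * Assembling the equivalences *)

(** Entrywise, [Y i j * (s j ^+ 2 - s i ^+ 2) = 0], and squaring is injective on
    nonnegative numbers. *)
Lemma comm_rdiag_sqr r (s : 'rV[R]_r) (Y : 'M[K]_r) :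
    (forall i, 0 <= s 0 i) ->
  comm_mx Y (rdiag s *m rdiag s) -> comm_mx Y (rdiag s).
Proof.
move=> s_ge0; rewrite /comm_mx mulmxA -[RHS]mulmxA => /matrixP YS.
apply/matrixP => i j; have := YS i j.
rewrite /rdiag !mul_mx_diag !mul_diag_mx !mxE => yE.
have [-> | yn0] := eqVneq (Y i j) 0; first by rewrite mul0r mulr0.
rewrite mulrC; congr (ofR _ * _).
apply/eqP; rewrite -(eqrXn2 (n := 2)) //; apply/eqP/(fmorph_inj ofR).
by apply: (mulIf yn0); rewrite !rmorphXn !expr2 /= -[RHS]mulrA -yE mulrC mulrA.
Qed.

(** With [G = W D W^H] for [W] with orthonormal columns and [D] positive
    diagonal, the hypothesis says that [X] preserves the span of [W], acting on
    it by [Y = W^H X W], and that [Y] commutes with [D *m D]. *)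
Lemma comm_sqr_gram n k (B : 'M[K]_(n, k)) (X : 'M[K]_n) : X^H = X ->
  comm_mx X (B *m B^H *m (B *m B^H)) -> comm_mx X (B *m B^H).
Proof.
move=> XH.
(* A plain decomposition of [B^H]: every vector is an eigenvector of [0]. *)
have [r [U [s [W [_ [svdB _]]]]]] :=
  essential_svd_exists (@adjmx0 R F n n) (mulmx0 _ _) (comm0mx (B^H^H *m B^H)).
have [_ [_ WW] _ s_gt0 _] := svdB.
have := svd_gram svdB; rewrite adjmxK => ->.
have Su := rdiag_unit s_gt0; set S := rdiag s in Su *.
have SS : S *m S = rdiag (\row_i (s 0 i) ^+ 2).
  rewrite /S /rdiag mul_mx_diag; apply/matrixP => i j; rewrite !mxE.
  by case: eqP => [->|_]; rewrite ?mulr1n ?mulr0n ?mul0r // rmorphXn expr2.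
have Du : S *m S \in unitmx by rewrite unitmx_mul Su.
rewrite SS in Du *.
pose s2 := \row_i s 0 i ^+ 2.
have D_comm Y : comm_mx Y (rdiag s2 *m rdiag s2) -> comm_mx Y (rdiag s2).
  by apply: comm_rdiag_sqr => i; rewrite mxE exprn_ge0 // ltW.
move: (rdiag (\row_i _)) Du D_comm => D Du D_comm {SS S Su}.
have -> : W *m D *m W^H *m (W *m D *m W^H) = W *m (D *m D) *m W^H.
  by rewrite !mulmxA -(mulmxA _ W^H W) WW mulmx1.
move=> XGG; move YE: (W^H *m X *m W) => Y.
have XW : X *m W *m (D *m D) = W *m (D *m D *m Y).
  have := congr1 (mulmx^~ W) XGG; rewrite -YE.
  by rewrite !mulmxA -(mulmxA _ W^H W) WW mulmx1.
have YDD : comm_mx Y (D *m D).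
  by rewrite /comm_mx -{1}YE -!(mulmxA W^H) XW (mulmxA W^H) WW mul1mx.
have XWE : X *m W = W *m Y.
  have DDu : D *m D \in unitmx by rewrite unitmx_mul Du.
  by apply: (can_inj (mulmxK DDu)); rewrite XW -YDD mulmxA.
have WX : W^H *m X = Y *m W^H.
  rewrite -[LHS]adjmxK adjmxM adjmxK XH XWE adjmxM -YE 2!adjmxM adjmxK XH.
  by rewrite mulmxA.
by rewrite /comm_mx !mulmxA XWE -(mulmxA W Y) D_comm // -!mulmxA WX.
Qed.

Lemma proj_gram_comm_gram m n k (A : 'M[K]_(m, n)) (B : 'M[K]_(n, k)) :
  proj_gram_comm (A^H *m A) (B *m B^H) <-> proj_gram_comm A B.
Proof.
have QE : B *m B^H *m (B *m B^H)^MP = B *m B^MP.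
  rewrite -[RHS]adj_colproj -rowproj_gram adjmxK.
  by rewrite -[LHS]adj_colproj cogram_adj.
rewrite /proj_gram_comm rowproj_gram QE gram_adj cogram_adj.
split=> [[PG QH] | [PG QH]]; last by split; apply: comm_mxM.
split; first exact: comm_sqr_gram (rowproj_hermitian A) PG.
rewrite -{2}[A]adjmxK; apply: comm_sqr_gram (colproj_hermitian B) _.
by rewrite adjmxK.
Qed.

(** By [isometry_align], [V V^H W S^2 W^H = W E S^2 W^H] with [E = M^H M]
    diagonal for [M = V^H W]; this is Hermitian as [E] commutes with [S]. *)
Lemma comm_of_isometry n r1 r2
    (V : 'M[K]_(n, r1)) (W : 'M[K]_(n, r2)) (s : 'rV[R]_r2) :
    V^H *m V = 1%:M -> W^H *m W = 1%:M -> diag_partial_isometry (V^H *m W) ->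
  comm_mx (V *m V^H) (W *m (rdiag s *m rdiag s) *m W^H).
Proof.
move=> VV WW [MMM _ /diag_mxP[E EE]]; have VM := isometry_align VV WW MMM.
have MV : W^H *m V *m V^H = diag_mx E *m W^H.
  have := congr1 (@adjmx _ _ _ _) VM.
  by rewrite EE !adjmxM !adjmxK -{1}EE => ->; rewrite -EE gram_adj.
rewrite EE in VM; set S := rdiag s.
have ES : diag_mx E *m (S *m S) = S *m S *m diag_mx E.
  have ES1 : diag_mx E *m S = S *m diag_mx E by exact: diag_mxC.
  by rewrite mulmxA ES1 -mulmxA ES1 mulmxA.
rewrite /comm_mx !mulmxA -(mulmxA V) VM -(mulmxA W) -(mulmxA W (_ *m _)).
by rewrite -(mulmxA (diag_mx E)) ES -!mulmxA (mulmxA W^H) MV.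
Qed.

Lemma svd_comm m n k (A : 'M[K]_(m, n)) (B : 'M[K]_(n, k)) rA rB
    (UA : 'M[K]_(m, rA)) sA (VA : 'M[K]_(n, rA)) (UB : 'M[K]_(n, rB)) sB VB :
    essential_reduced_svd A UA sA VA -> essential_reduced_svd B UB sB VB ->
    diag_partial_isometry (VA^H *m UB) ->
  comm_mx (A^MP *m A) (B *m B^H).
Proof.
move=> svdA svdB Mi.
have [_ [_ VV] _ _ _] := svdA; have [_ [WW _] _ _ _] := svdB.
have := svd_gram (svd_adj svdB); rewrite adjmxK => ->.
by rewrite (svd_rowproj svdA); apply: comm_of_isometry.
Qed.

Definition aligned_svds m n k (A : 'M[K]_(m, n)) (B : 'M[K]_(n, k)) : Prop :=
  exists (rA rB : nat)
    (UA : 'M[K]_(m, rA)) (sA : 'rV[R]_rA) (VA : 'M[K]_(n, rA))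
    (UB : 'M[K]_(n, rB)) (sB : 'rV[R]_rB) (VB : 'M[K]_(k, rB)),
    [/\ essential_reduced_svd A UA sA VA,
        essential_reduced_svd B UB sB VB
      & unitary_block (VA^H *m UB) \/ VA^H *m UB = 0].

(** From right to left, [M *m M^H = VA^H *m Q *m VA] because [UB *m UB^H = Q],
    and it is diagonal because the columns of [VA] are eigenvectors of [Q]. *)
Lemma aligned_svdsP m n k (A : 'M[K]_(m, n)) (B : 'M[K]_(n, k)) :
  aligned_svds A B <-> proj_gram_comm A B.
Proof.
split=> [[rA [rB [UA [sA [VA [UB [sB [VB [svdA svdB M]]]]]]]]] | AB].
  have Mi : diag_partial_isometry (VA^H *m UB).
    case: M => [|->]; first exact: unitary_block_isometry.
    by split; rewrite ?mul0mx ?mulmx0 ?mx0_is_diag.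
  split; first exact: svd_comm svdA svdB Mi.
  have Mi' : diag_partial_isometry (UB^H *m VA).
    have -> : UB^H *m VA = (VA^H *m UB)^H by rewrite adjmxM adjmxK.
    move: (VA^H *m UB) Mi => N [MMM d1 d2]; split; rewrite ?adjmxK //.
    by rewrite -[in RHS]MMM 2!adjmxM adjmxK mulmxA.
  have := svd_comm (svd_adj svdB) (svd_adj svdA) Mi'.
  by rewrite adj_colproj adjmxK.
have [PG QH] := AB.
have QQ : B *m B^MP *m (B *m B^MP) = B *m B^MP by rewrite mulmxA mpinvK.
have PP : A^MP *m A *m (A^MP *m A) = A^MP *m A by rewrite mulmxA mpinvVK.
have [rA [UA [sA [VA [qA [svdA QV]]]]]] :=
  essential_svd_exists (colproj_hermitian B) QQ QH.
have PG' : comm_mx (A^MP *m A) (B^H^H *m B^H) by rewrite adjmxK.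
have [rB [VB [sB [UB [qB [svdB PU]]]]]] :=
  essential_svd_exists (rowproj_hermitian A) PP PG'.
have [_ [_ VV] _ _ _] := svdA; have [_ [_ UU] _ _ _] := svdB.
exists rA, rB, UA, sA, VA, UB, sB, VB; split=> //.
  by rewrite -[B]adjmxK; apply: svd_adj.
left; apply: isometry_unitary_block.
have QE : B *m B^MP = UB *m UB^H by rewrite -(svd_rowproj svdB) adj_colproj.
rewrite QE in QV; rewrite (svd_rowproj svdA) in PU.
have M1 : VA^H *m UB *m (VA^H *m UB)^H = rdiag qA.
  by rewrite adjmxM adjmxK mulmxA -(mulmxA VA^H) -mulmxA QV mulmxA VV mul1mx.
have M2 : (VA^H *m UB)^H *m (VA^H *m UB) = rdiag qB.
  by rewrite adjmxM adjmxK mulmxA -(mulmxA UB^H) -mulmxA PU mulmxA UU mul1mx.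
split; rewrite ?M1 ?M2 ?diag_mx_is_diag //.
have QV' : VA^H *m (UB *m UB^H) = rdiag qA *m VA^H.
  have := congr1 (@adjmx _ _ _ _) QV.
  by rewrite !adjmxM adjmx_rdiag !adjmxK.
by rewrite mulmxA -QV' -!mulmxA UU mulmx1.
Qed.

End ReverseOrderLaw.

Theorem theorem1p2 (R : realType) (F : base_field) (m n k : nat)
    (A : 'M[scalars R F]_(m, n)) (B : 'M[scalars R F]_(n, k)) :
  [<-> (A *m B)^MP = B^MP *m A^MP;
       exists (rA rB : nat)
         (UA : 'M[scalars R F]_(m, rA)) (sA : 'rV[R]_rA) (VA : 'M[scalars R F]_(n, rA))
         (UB : 'M[scalars R F]_(n, rB)) (sB : 'rV[R]_rB) (VB : 'M[scalars R F]_(k, rB)),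
         [/\ essential_reduced_svd A UA sA VA,
             essential_reduced_svd B UB sB VB
           & unitary_block (VA^H *m UB) \/ VA^H *m UB = 0];
       colspace (A^H *m A *m B) = colspace (B *m B^H *m A^H);
       ((A^H *m A) *m (B *m B^H))^MP = (B *m B^H)^MP *m (A^H *m A)^MP;
       comm_mx (A^MP *m A) (B *m B^H) /\ comm_mx (B *m B^MP) (A^H *m A)].
Proof.
tfae.
- by move/reverse_order_lawP/aligned_svdsP.
- by move/aligned_svdsP/colspace_gramP.
- by move/colspace_gramP/proj_gram_comm_gram/reverse_order_lawP.
- by move/reverse_order_lawP/proj_gram_comm_gram.
- by move/comm_reverse_order.
Qed.
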